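(* For every $k\in\mathbb{N}$, every graph $G$ and every set $\mathcal{A}\subseteq V(G)$, either $G$ contains $k$ pairwise anti-complete $\mathcal{A}$-paths, or there exists a set $Z\subseteq V(G)$ with $|Z|\leq 4(k-1)$ such that $G-N_G[Z,4]$ has no $\mathcal{A}$-paths.
   Context: $\mathbb{N}=\{1,2,\dots\}$. Graphs are finite, simple and undirected. For a graph $G$ and $\mathcal{A}\subseteq V(G)$, an $\mathcal{A}$-path in $G$ is a path in $G$ (not necessarily induced) with at least one edge whose two endpoints belong to $\mathcal{A}$ (internal vertices may also belong to $\mathcal{A}$). Two sets $X,Y\subseteq V(G)$ are anti-complete if $X\cap Y=\emptyset$ and there is no edge of $G$ with one end in $X$ and the other in $Y$; two paths in $G$ are anti-complete if their vertex sets are. For $Z\subseteq V(G)$ and $r\in\mathbb{N}$, $N_G[Z,r]$ is the set of vertices of $G$ at distance at most $r$ in $G$ from some vertex of $Z$. For $S\subseteq V(G)$, $G-S$ is the subgraph of $G$ induced by $V(G)\setminus S$; an $\mathcal{A}$-path of $G-S$ is an $\mathcal{A}$-path of $G$ all of whose vertices avoid $S$. *)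

(* Defs.v *)
From mathcomp Require Import all_boot.

Set Implicit Arguments.
Unset Strict Implicit.
Unset Printing Implicit Defensive.

Record sgraph := SGraph {
  vertex :> finType;
  edge : rel vertex;
  edge_sym : symmetric edge;
  edge_irr : irreflexive edge
}.

(* A path is given, as in path.v, by its first vertex x and the sequence p of
   the remaining ones, so that size p is its number of edges. *)
Definition is_path (G : sgraph) (x : G) (p : seq G) : bool :=
  path (@edge G) x p && uniq (x :: p).

Definition Apath (G : sgraph) (A : {set G}) (s : seq G) : bool :=
  if s is x :: p then
    [&& is_path x p, 0 < size p, x \in A & last x p \in A]
  else false.

Definition anticomplete (G : sgraph) (X Y : {set G}) : bool :=
  [disjoint X & Y] && [forall x in X, forall y in Y, ~~ edge x y].

Definition path_of_length (G : sgraph) (x y : G) (d : nat) : bool :=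
  [exists p : d.-tuple G, is_path x p && (last x p == y)].

(* Holds for no d when x and y lie in different components. *)
Definition is_dist (G : sgraph) (x y : G) (d : nat) : bool :=
  path_of_length x y d && [forall d' : 'I_d, ~~ path_of_length x y d'].

Definition ball (G : sgraph) (Z : {set G}) (r : nat) : {set G} :=
  [set x | [exists z in Z, exists d : 'I_r.+1, is_dist z x d]].

(* A-paths of G - S, seen as A-paths of G. *)
Definition Apath_avoiding (G : sgraph) (S A : {set G}) (s : seq G) : bool :=
  Apath A s && all (fun v => v \notin S) s.

(* Main.v *)
Require Import Defs.
From Stdlib Require Import Classical_Prop.
From mathcomp Require Import all_boot zify.

Set Implicit Arguments.
Unset Strict Implicit.
Unset Printing Implicit Defensive.

(** Grow a rooted forest in [G] greedily, together with a set [Z] that starts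
    empty.  As long as some [A]-path avoids the ball [X] of radius 4 around
    [Z], add a shortest walk of [G - X] from [A] to the closed neighbourhood of
    the forest (a leg), or, if there is none, a shortest walk of [G - X] between
    two distinct vertices of [A] (a new component).  Both ends of the added walk
    join [Z], and its first vertex becomes a tip of the forest.  So
    [#|Z| <= 2 * #|T|] for the set [T] of tips, and the final [Z] meets all
    [A]-paths within distance 4 ([hitting_frame]).  What remains is that a
    forest grown in this way contains at least [#|T| / 2] pairwise anti-complete
    [A]-paths ([frame_packing]): with at most [k - 1] of them,
    [#|Z| <= 2 * #|T| <= 4 * (k - 1)].

    Shortness makes the forest almost induced ([frame_extend]).  Let [v] be a
    vertex outside the ball.  It cannot have neighbours both on the last added
    walk [l] and in the older forest: following [l] to the neighbour of [v] and
    stepping to [v] would have given a competing leg.  If [l] is a new component,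
    there was none; if [l] is a leg, the competitor is not shorter, which puts
    [v] within distance 2 of the end of [l], a vertex of [Z].  And its neighbours
    on [l] alone span at most three consecutive vertices, or the detour through
    [v] would shorten [l].  So each new leg attaches in one place, which is far
    from [Z], hence far from the previous tips, roots and branch vertices.  The forest has therefore
    maximum degree three, no two branch vertices are adjacent, and every edge of
    [G] between its vertices that is not a forest edge is a chord from the end
    of a leg to an ancestor at most three steps above it.

    For the packing, each tip sends a token towards the root and two tokens
    that meet cancel.  The forest edges crossed by a token (a [T]-join) form
    disjoint paths.  The top vertex of such a path has absorbed at most two
    tokens, so there are at least [#|T| / 2] tops ([tops_card]); below each top
    are two vertices of [A], or one and the top is itself a root, which is in
    [A] ([top_Apath]).  Two of these paths are anti-complete because a chord
    runs along a branch-free stretch of the forest, so a token crosses all of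
    the stretch or none of it ([link_top]). *)

(** * Neighbourhoods of a set of vertices *)

Section Neighbourhoods.
Variable G : sgraph.
Implicit Types Z : {set G}.

Definition thicken (S : {set G}) : {set G} :=
  S :|: [set y | [exists x in S, edge x y]].

(** The ball of radius [r] around [Z], presented by steps, which suits
    arguments that move along edges better than the distances in [ball]. *)
Definition near Z r : {set G} := iter r thicken Z.

Lemma near_step Z r x y : x \in near Z r -> edge x y -> y \in near Z r.+1.
Proof.
by move=> xZ xy; rewrite /= in_setU inE; apply/orP; right; apply/existsP; exists x; rewrite xZ.
Qed.

Lemma near_sub Z r r' : r <= r' -> near Z r \subset near Z r'.
Proof.
move=> /subnK <-; elim: (r' - r) => [|n IHn] //.
by apply: subset_trans IHn _; rewrite addSn /= subsetUl.
Qed.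

Lemma far_step Z r x y : x \notin near Z r.+1 -> edge x y -> y \notin near Z r.
Proof. by move=> xZ xy; apply: contra xZ => /near_step; apply; rewrite edge_sym. Qed.

Lemma far_le Z r r' x : r' <= r -> x \notin near Z r -> x \notin near Z r'.
Proof. by move=> le_r; apply: contra; apply: (subsetP (near_sub Z le_r)). Qed.

(** A walk of length at most [r] shortens to a path, and a shortest path
    witnesses a distance. *)
Lemma ball_walk Z z p r : z \in Z -> path (@edge G) z p -> size p <= r ->
  last z p \in ball Z r.
Proof.
move=> zZ pP; case/shortenP: pP => p' p'P p'U sub_p' le_r.
have le_p' : size p' <= r.
  apply: leq_trans le_r; apply: uniq_leq_size => //.
  by case/andP: p'U.
have ex_d : exists d, path_of_length z (last z p') d.
  by exists (size p'); apply/existsP; exists (in_tuple p'); rewrite /is_path p'P p'U /=.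
case: (ex_minnP ex_d) => d dP d_min.
have le_d : d <= size p'.
  by apply: d_min; apply/existsP; exists (in_tuple p'); rewrite /is_path p'P p'U /=.
rewrite inE; apply/existsP; exists z; rewrite zZ /=; apply/existsP.
have lt_d : d < r.+1 by rewrite ltnS (leq_trans le_d).
exists (Ordinal lt_d); rewrite /is_dist dP /=; apply/forallP => d'.
by apply/negP => /d_min; rewrite leqNgt ltn_ord.
Qed.

Lemma near_mono Z Z' r : Z \subset Z' -> near Z r \subset near Z' r.
Proof.
move=> sZ; elim: r => [|r IHr]; first exact: sZ.
apply/subsetP => x /setUP[/(subsetP IHr) H|]; first by rewrite /= in_setU H.
rewrite inE => /existsP[z /andP[/(subsetP IHr) zZ zx]].
exact: near_step zZ zx.
Qed.

Lemma near_ball Z r : near Z r \subset ball Z r.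
Proof.
apply/subsetP => x xZ.
suff [z [p [zZ pP <- le_p]]] : exists z p,
    [/\ z \in Z, path (@edge G) z p, last z p = x & size p <= r].
  exact: ball_walk zZ pP le_p.
elim: r x xZ => [|r IHr] x /=; first by exists x, [::].
rewrite in_setU inE => /orP[/IHr|/existsP[y /andP[/IHr[z [p [zZ pP pl le_p]]] yx]]].
  by case=> z [p [zZ pP pl le_p]]; exists z, p; split=> //; apply: leqW.
by exists z, (rcons p x); rewrite rcons_path last_rcons size_rcons pl pP.
Qed.

Lemma ball_mono Z Z' r : Z \subset Z' -> ball Z r \subset ball Z' r.
Proof.
move=> sZ; apply/subsetP => x; rewrite !inE => /existsP[z /andP[zZ zx]].
by apply/existsP; exists z; rewrite (subsetP sZ).
Qed.

Lemma far_of_ball Z r x : x \notin ball Z r -> x \notin near Z r.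
Proof. by apply: contra; apply: (subsetP (near_ball Z r)). Qed.
End Neighbourhoods.

(** * Frames: the forests that the greedy process grows *)

Section Frames.
Variables (G : sgraph) (A : {set G}).
Implicit Types (s : seq G) (par : G -> G) (T Z U : {set G}).

Definition kids s par v : {set G} := [set c | [&& c \in s, par c == v & c != v]].

(** [~~ single s par v] says that [v] is a branch vertex. *)
Definition single s par v := #|kids s par v| <= 1.

(** An edge of [G] inside the forest, directed upwards: a forest edge, or a chord
    that skips one or two vertices and leaves the end [x] of a leg.  The
    branching conditions make all the forest edges beside a chord carry a token
    as soon as both its ends lie on token paths. *)
Definition link s par Z (x y : G) : Prop :=
  [\/ [/\ par x <> x, y = par x & single s par x || single s par y],
      [/\ x \in Z, single s par x, par x <> x, par (par x) <> par x &
          y = par (par x) /\ single s par y] |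
      [/\ x \in Z, single s par x, par x <> x, par (par x) <> par x &
          [/\ par (par (par x)) <> par (par x), y = par (par (par x)),
              single s par (par (par x)) & single s par y]]].

(** The forest has the vertices of [s], where children come before parents, and
    the roots are the fixed points of [par].  Tips and roots are the intended ends
    of the [A]-paths to be packed.  [frame_branch] keeps branch vertices close to
    [Z], so that new attachments, made far from [Z], are far from them.
    [frame_window] says that whatever is added later attaches in one place
    only. *)
Record frame s par T Z : Prop := Frame {
  frame_uniq : uniq s;
  frame_par v : v \in s -> par v <> v ->
    [/\ par v \in s, edge v (par v) & index v s < index (par v) s];
  frame_root v : v \in s -> par v = v ->
    [/\ v \in Z, v \in A & single s par v];
  frame_tip v : v \in T ->
    [/\ v \in s, v \in A, v \in Z, par v <> v & kids s par v = set0];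
  frame_kids v : #|kids s par v| <= 2;
  frame_branch v : ~~ single s par v -> v \in near Z 1;
  frame_A v : v \in s -> v \in A -> v \in Z;
  frame_link x y : x \in s -> y \in s -> edge x y ->
    link s par Z x y \/ link s par Z y x;
  frame_window v : v \notin ball Z 4 -> v \notin s ->
    (exists2 h, h \in s & edge v h) ->
    exists y, [/\ y \in s, edge v y & forall h, h \in s -> edge v h ->
                  h \in [:: y; par y; par (par y)]];
  frame_card : #|Z| <= 2 * #|T|
}.

Lemma frame0 : frame [::] id set0 set0.
Proof.
have k0 v : kids [::] id v = set0 by apply/setP => c; rewrite !inE.
split=> //; first 1 [by move=> v; rewrite inE].
- by move=> v; rewrite k0 cards0.
- by move=> v; rewrite /single k0 cards0.
- by move=> v _ _ [].
- by rewrite !cards0.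
Qed.

(** * Packing anti-complete paths in a frame *)

Lemma anticomplete_sub (X Y X' Y' : {set G}) : X' \subset X -> Y' \subset Y ->
  anticomplete X Y -> anticomplete X' Y'.
Proof.
move=> sX sY /andP[dXY /forallP nXY]; apply/andP; split.
  exact: disjointWl sX (disjointWr sY dXY).
apply/forallP => x; apply/implyP => xX; apply/forallP => y; apply/implyP => yY.
have /implyP/(_ (subsetP sX _ xX))/forallP/(_ y)/implyP := nXY x.
by apply; apply: (subsetP sY).
Qed.

Section Packing.
Variables (s : seq G) (par : G -> G) (T Z : {set G}).
Hypothesis fr : frame s par T Z.
Notation kids := (kids s par).
Notation single := (single s par).

(** [U] is to be the set of vertices whose edge to the parent carries a token:
    a vertex passes one on exactly when it holds an odd number, counting its own
    if it is a tip.  Roots pass nothing on. *)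
Definition parity_rule U v :=
  (v \in U) = (par v != v) && odd ((v \in T) + #|kids v :&: U|).

(** The rule at [v] involves only the children of [v], which come earlier in
    [s], so [U] can be decided vertex by vertex. *)
Lemma ex_used : exists U, U \subset s /\ {in s, forall v, parity_rule U v}.
Proof.
suff /(_ _ (leqnn _))[U [sU UP]] n : n <= size s -> exists U, U \subset s /\
    forall v, v \in s -> index v s < n -> parity_rule U v.
  by exists U; split=> // v vs; apply: UP => //; rewrite index_mem.
elim: n => [|n IHn] le_n.
  by exists set0; split=> //; apply/subsetP => x; rewrite inE.
have [U0 [sU0 U0P]] := IHn (ltnW le_n).
have [x xs xn] : exists2 x, x \in s & index x s = n.
  case: s fr le_n => // x0 s' fr' lt_n; exists (nth x0 (x0 :: s') n); first exact: mem_nth.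
  by rewrite index_uniq ?(frame_uniq fr').
pose b := (par x != x) && odd ((x \in T) + #|kids x :&: U0|).
exists (if b then x |: U0 else U0 :\ x).
have kidsE v : v \in s -> index v s < n.+1 ->
    kids v :&: (if b then x |: U0 else U0 :\ x) = kids v :&: U0.
  move=> vs; rewrite ltnS => le_v; apply/setP => c; rewrite !in_setI.
  case ck: (c \in kids v) => //=; have /negPf cx : c != x.
    apply: contraTneq ck => ->; rewrite inE xs /=; apply/negP => /andP[/eqP pv xv].
    have /(frame_par fr xs)[_ _] : par x <> x by rewrite pv => e; rewrite e eqxx in xv.
    by rewrite pv xn ltnNge le_v.
  by case: ifP => _; rewrite !inE cx.
split.
  apply/subsetP => y; case: ifP => _; first by case/setU1P => [->|/(subsetP sU0)].
  by case/setD1P => _ /(subsetP sU0).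
move=> v vs lt_v; rewrite /parity_rule kidsE //.
case: (eqVneq v x) => [->|vx].
  by rewrite -/b; case: {kidsE} b; rewrite !inE eqxx.
have lt_v' : index v s < n.
  rewrite ltn_neqAle -ltnS lt_v andbT -xn; apply: contra_neq vx => e.
  by rewrite -(nth_index x vs) e nth_index.
rewrite -(U0P v vs lt_v').
by case: ifP => _; rewrite !inE (negPf vx).
Qed.

Section Used.
Variable U : {set G}.
Hypothesis sub_U : U \subset s.
Hypothesis U_rule : {in s, forall v, parity_rule U v}.

(** The highest vertices of the token paths, where tokens cancel or reach a
    root. *)
Definition tops : {set G} := [set v in s | (v \notin U) && (kids v :&: U != set0)].

Definition down v := if v \in U then par v else v.

Definition top_of v := iter (size s) down v.

Lemma used_nonroot v : v \in U -> par v <> v.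
Proof.
move=> vU; have := U_rule (subsetP sub_U _ vU).
by rewrite /parity_rule vU => /esym/andP[/eqP].
Qed.

Lemma tip_used v : v \in T -> v \in U.
Proof.
move=> vT; have [vs _ _ nr k0] := frame_tip fr vT.
by rewrite (U_rule vs) vT k0 set0I cards0 andbT; apply/eqP.
Qed.

Lemma used_kid v : v \in U :|: tops -> v \notin T -> exists2 c, c \in kids v & c \in U.
Proof.
move=> vF vT; suff /set0Pn[c] : kids v :&: U != set0.
  by rewrite inE => /andP[ck cU]; exists c.
move: vF; rewrite !inE => /orP[vU|/and3P[] //].
move: (vU); rewrite (U_rule (subsetP sub_U _ vU)) (negPf vT) => /andP[_].
by apply: contraTneq => ->; rewrite cards0.
Qed.

(** Count tokens: the number of tokens that [v] receives, plus one if it is a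
    tip, is at most one if [v] passes a token on, at most two if [v] is a top,
    and zero otherwise.  The tokens received in total are those passed on. *)
Lemma tops_card : #|T| <= 2 * #|tops|.
Proof.
have sumU : \sum_v #|kids v :&: U| = #|U|.
  transitivity (\sum_v \sum_(u in U) (u \in kids v : nat)).
    apply: eq_bigr => v _; rewrite -sum1_card big_mkcond [RHS]big_mkcond /=.
    by apply: eq_bigr => u _; rewrite in_setI; case: (u \in kids v); case: (u \in U).
  rewrite exchange_big /= -sum1_card; apply: eq_bigr => u uU.
  rewrite (bigD1 (par u)) //= big1 ?addn0.
    rewrite inE eqxx (subsetP sub_U _ uU) /=.
    by case: eqP (used_nonroot uU) => // e; rewrite -e.
  by move=> v /negPf nv; rewrite inE eq_sym nv andbF.
have ind (B : {set G}) : \sum_v (v \in B : nat) = #|B|.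
  by rewrite -sum1_card [RHS]big_mkcond; apply: eq_bigr => v _; case: (v \in B).
rewrite -(leq_add2l #|U|) -{1}sumU -!ind -big_split /= big_distrr -big_split /=.
apply: leq_sum => v _; case vT: (v \in T).
  have [_ _ _ _ ->] := frame_tip fr vT.
  by rewrite set0I cards0 (tip_used vT).
rewrite addn0; case vs: (v \in s); last first.
  rewrite (_ : kids v :&: U = set0) ?cards0 //; apply/setP => c; rewrite !inE.
  apply/negP => /andP[/and3P[cs /eqP pc cv] _].
  have nr : par c <> c by rewrite pc => e; rewrite e eqxx in cv.
  by have [] := frame_par fr cs nr; rewrite pc vs.
have le2 : #|kids v :&: U| <= 2.
  by apply: leq_trans (frame_kids fr v); apply: subset_leq_card; apply: subsetIl.
case vU: (v \in U).
  have := U_rule vs; rewrite /parity_rule vU vT add0n => /esym/andP[_].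
  by case: #|_| le2 => [|[|[|]]].
rewrite inE vs vU /= add0n -cards_eq0; case: #|_| le2 => [|[|[|]]] //.
Qed.

(** Parents come later in [s], so after [size s] moves every token has reached
    its top. *)
Lemma down_top v : v \in s -> down (top_of v) = top_of v.
Proof.
rewrite /top_of => vs.
suff H n v' : v' \in s -> size s - index v' s <= n -> down (iter n down v') = iter n down v'.
  by apply: H => //; rewrite leq_subr.
elim: n v' => [|n IHn] v' v's; first by rewrite leqn0 subn_eq0 leqNgt index_mem v's.
move=> le_n; rewrite iterSr; case v'U: (v' \in U); last first.
  have e : down v' = v' by rewrite /down v'U.
  have -> : iter n down (down v') = v' by rewrite -iterSr; elim: n.+1 => //= m ->.
  by [].
have e : down v' = par v' by rewrite /down v'U.
have [ps _ lt] := frame_par fr v's (used_nonroot v'U).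
rewrite e; apply: IHn => //; rewrite -ltnS (leq_trans _ le_n) // ltn_sub2l //.
by rewrite index_mem.
Qed.

Lemma top_of_used v : v \in U -> top_of (par v) = top_of v.
Proof.
move=> vU; have e : par v = down v by rewrite /down vU.
by rewrite e /top_of -iterSr iterS; apply: down_top; apply: (subsetP sub_U).
Qed.

Lemma top_of_unused v : v \notin U -> top_of v = v.
Proof.
move=> vU; rewrite /top_of; elim: (size s) => //= n ->.
by rewrite /down (negPf vU).
Qed.

(** The vertex set of the token path with top [w]; [U :|: tops] consists of all
    the vertices met by tokens. *)
Definition piece w : {set G} := [set v in U :|: tops | top_of v == w].

Definition piece_rel w : rel G :=
  [rel x y | [&& edge x y, x \in piece w & y \in piece w]].

Lemma used_par v : v \in U -> par v \in U :|: tops.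
Proof.
move=> vU; have nr := used_nonroot vU.
have vs := subsetP sub_U _ vU.
have [ps _ _] := frame_par fr vs nr.
rewrite !inE ps; case: (par v \in U) => //=; apply/set0Pn; exists v.
by rewrite !inE vs eqxx vU /= andbT; apply/eqP/nesym.
Qed.

Lemma piece_edge w v : v \in U -> top_of v = w -> piece_rel w v (par v).
Proof.
move=> vU vw; have vs := subsetP sub_U _ vU.
have [_ e _] := frame_par fr vs (used_nonroot vU).
by rewrite /piece_rel /= e !inE vU top_of_used // vw eqxx !andbT; have := used_par vU; rewrite !inE.
Qed.

(** Follow a token backwards: a vertex that passes a token on is a tip or has a
    child that does.  The equation [iter n down a = u] later tells apart the
    tips reached through different children. *)
Lemma climb w u : u \in U -> top_of u = w -> exists a n,
  [/\ a \in T, a \in piece w, iter n down a = u & connect (piece_rel w) a u].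
Proof.
have [n] := ubnP (index u s); elim: n u => // n IHn u; rewrite ltnS => le_n uU uw.
case uT: (u \in T).
  by exists u, 0; split=> //; rewrite !inE uU uw eqxx.
have [|c ck cU] := used_kid (v := u) _ (negbT uT); first by rewrite inE uU.
move: ck; rewrite inE => /and3P[cs /eqP pc cu].
have nr := used_nonroot cU.
have [_ _ lt] := frame_par fr cs nr.
have cw : top_of c = w by rewrite -top_of_used // pc.
have [|a [m [aT aw ac con]]] := IHn c _ cU cw.
  by rewrite pc in lt; apply: leq_trans lt le_n.
exists a, m.+1; split=> //; first by rewrite iterS ac /down cU.
apply: connect_trans con (connect1 _); rewrite -pc; exact: piece_edge.
Qed.

Lemma piece_rel_sym w : connect_sym (piece_rel w).
Proof.
apply: sym_connect_sym => x y; rewrite /piece_rel /= edge_sym; congr (_ && _).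
by rewrite andbC.
Qed.

(** A top that is not a root holds an even positive number of tokens, so two
    children passed one on; climbing from each finds two tips, which differ
    since the way down from a tip is unique.  A root at the top is itself in [A],
    and one climb is enough. *)
Lemma top_Apath w : w \in tops -> exists2 p, Apath A p & {subset p <= piece w}.
Proof.
move=> wt; have := wt; rewrite inE => /and3P[ws wU /set0Pn[c1]].
rewrite !inE => /andP[/and3P[c1s /eqP p1 c1w] c1U].
have w_top := top_of_unused wU.
have top_kid c : c \in U -> par c = w -> top_of c = w.
  by move=> cU pc; rewrite -top_of_used // pc.
(* Inside [piece w] it is enough to connect two distinct vertices of [A]. *)
suff [a1 [a2 [[a1A a2A a12] [a1w con]]]] : exists a1 a2,
    [/\ a1 \in A, a2 \in A & a1 != a2] /\ a1 \in piece w /\ connect (piece_rel w) a1 a2.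
  case/connectP: con => p pP pl; move: a2A a12; rewrite pl.
  case/shortenP: pP => p' p'P p'U _ a2A a12.
  exists (a1 :: p').
    rewrite /= /is_path p'U a1A a2A !andbT; apply/andP; split.
      by apply: sub_path p'P => x y /= /andP[].
    by case: p' a12 {p'P p'U a2A} => //=; rewrite eqxx.
  move=> x; rewrite inE => /predU1P[-> //|].
  elim: p' a1 p'P {p'U a2A a12 pl a1A a1w} => //= y p' IHp a1 /andP[/and3P[_ _ yw] yP].
  by rewrite inE => /predU1P[-> //|]; apply: IHp yP.
have [a1 [n1 [a1T a1w it1 con1]]] := climb c1U (top_kid _ c1U p1).
have con1w : connect (piece_rel w) a1 w.
  apply: connect_trans con1 (connect1 _); rewrite -p1; apply: piece_edge => //.
  by rewrite p1; apply: top_kid.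
have [_ a1A _ nr1 _] := frame_tip fr a1T.
case: (eqVneq (par w) w) => [rw|/eqP nrw].
  have [_ wA _] := frame_root fr ws rw.
  exists a1, w; do !split=> //; apply: contra_notN nr1 => /eqP e; by rewrite e.
have /set0Pn[c2] : (kids w :&: U) :\ c1 != set0.
  have := U_rule ws; rewrite /parity_rule (negPf wU); move/eqP: (nrw) => -> /= ev.
  have wT : w \notin T by apply: contra wU; apply: tip_used.
  move: ev; rewrite (negPf wT) add0n (cardsD1 c1) !inE c1s p1 eqxx c1w c1U /=.
  by rewrite -cards_eq0; case: #|_|.
rewrite !inE => /and3P[c21 /and3P[c2s /eqP p2 c2w] c2U].
have [a2 [n2 [a2T a2w it2 con2]]] := climb c2U (top_kid _ c2U p2).
have [_ a2A _ nr2 _] := frame_tip fr a2T.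
exists a1, a2; do !split=> //; last first.
  apply: connect_trans con1w _; rewrite piece_rel_sym.
  apply: connect_trans con2 (connect1 _); rewrite -p2; apply: piece_edge => //.
  by rewrite p2; apply: top_kid.
have fixw n : iter n down w = w by elim: n => //= n ->; rewrite /down (negPf wU).
(* A token that has passed through the child [c] of [w] stays at [w]. *)
have chain c c' n n' a : c \in U -> par c = w -> c' != w ->
    iter n down a = c -> iter n' down a = c' -> n < n' -> False.
  move=> cU pc c'w e e' lt.
  move: c'w; rewrite -e' -(subnK lt) iterD iterS e /down cU pc -/down.
  by rewrite fixw eqxx.
apply/eqP => e12; rewrite -e12 in it2.
case: (ltngtP n1 n2) => lt.
- exact: chain c1U p1 c2w it1 it2 lt.
- exact: chain c2U p2 c1w it2 it1 lt.
- by move: c21; rewrite -it1 -it2 lt eqxx.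
Qed.

(** A vertex met by tokens that is not a tip receives one from some child, hence
    from its only child. *)
Lemma single_used u v : u \in s -> par u = v -> u <> v -> single v ->
  v \in U :|: tops -> u \in U.
Proof.
move=> us pu uv sv vF.
have uk : u \in kids v by rewrite inE us pu eqxx; apply/eqP.
have vT : v \notin T.
  by apply/negP => /(frame_tip fr)[_ _ _ _ k0]; rewrite k0 inE in uk.
have [c ck cU] := used_kid vF vT.
by move/card_le1_eqP: sv => /(_ _ _ uk ck) <-.
Qed.

(** Tokens do not cancel at a non-root vertex with at most one child. *)
Lemma single_nonroot_used u : par u <> u -> single u -> u \in U :|: tops -> u \in U.
Proof.
move=> nr su; rewrite !inE => /orP[//|/and3P[us uU k0]].
have := U_rule us; rewrite /parity_rule; move/eqP: nr (nr) => -> nr /= ->.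
have uT : u \notin T by apply: contra uU; apply: tip_used.
rewrite (negPf uT) add0n (_ : #|_| = 1) //; apply/eqP; rewrite eqn_leq.
rewrite lt0n cards_eq0 k0 andbT; apply: leq_trans su.
by apply: subset_leq_card; apply: subsetIl.
Qed.

(** Every forest edge between [x] and [y] carries a token, because tokens do not
    cancel at its lower end or because its upper end has no other child to
    receive a token from. *)
Lemma link_top x y : x \in s -> link s par Z x y ->
  x \in U :|: tops -> y \in U :|: tops -> top_of x = top_of y.
Proof.
move=> xs lk xF yF; case: lk.
- case=> nr yE /orP[sx|sy].
    have xU := single_nonroot_used nr sx xF.
    by rewrite yE top_of_used.
  have xU : x \in U by apply: (@single_used x y) => //; rewrite yE; exact/nesym.
  by rewrite yE top_of_used.
- case=> _ sx nr1 nr2 [yE sy].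
  have xU := single_nonroot_used nr1 sx xF.
  have [xs1 _ _] := frame_par fr xs nr1.
  have x1U : par x \in U by apply: (@single_used _ y) => //; rewrite yE; exact/nesym.
  by rewrite yE !top_of_used.
- case=> _ sx nr1 nr2 [nr3 yE s2 sy].
  have xU := single_nonroot_used nr1 sx xF.
  have [xs1 _ _] := frame_par fr xs nr1.
  have [xs2 _ _] := frame_par fr xs1 nr2.
  have x2U : par (par x) \in U by apply: (@single_used _ y) => //; rewrite yE; exact/nesym.
  have x1U : par x \in U.
    by apply: (@single_used _ (par (par x))) => //; [exact/nesym | rewrite inE x2U].
  by rewrite yE !top_of_used.
Qed.

Lemma pieces_anticomplete w w' : w != w' -> anticomplete (piece w) (piece w').
Proof.
have sF v : v \in U :|: tops -> v \in s.
  by rewrite !inE => /orP[/(subsetP sub_U)//|/andP[]].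
move=> ww'; apply/andP; split.
  apply/pred0P => x /=; rewrite !inE; apply/negP => /andP[/andP[_ /eqP ->]].
  by rewrite (negPf ww') andbF.
apply/forallP => x; apply/implyP; rewrite inE => /andP[xF /eqP xw].
apply/forallP => y; apply/implyP; rewrite inE => /andP[yF /eqP yw].
apply/negP => xy; case/negP: ww'; rewrite -xw -yw; apply/eqP.
case: (frame_link fr (sF _ xF) (sF _ yF) xy) => lk; first exact: link_top (sF _ xF) lk xF yF.
by apply/esym; apply: link_top (sF _ yF) lk yF xF.
Qed.
End Used.

Lemma frame_packing k : 2 * k.-1 < #|T| -> 
  exists P : 'I_k -> seq G, (forall i, Apath A (P i)) /\
    (forall i j, i != j -> anticomplete [set x in P i] [set x in P j]).
Proof.
move=> lt_T; have [U [sU UP]] := ex_used.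
pose W := tops U.
have le_k : k <= #|W|.
  have := tops_card sU UP; rewrite -/W => /(leq_trans lt_T).
  by rewrite ltn_pmul2l //; case: (k).
have /fin_all_exists2[P PA Psub] (i : 'I_k) : exists2 p, Apath A p &
    {subset p <= piece U (enum_val (widen_ord le_k i))}.
  exact: top_Apath (enum_valP _).
exists P; split=> // i j ij.
apply: anticomplete_sub (pieces_anticomplete sU UP _);
  first by apply/subsetP => x; rewrite inE; apply: Psub.
- by apply/subsetP => x; rewrite inE; apply: Psub.
- by apply: contra ij => /eqP/enum_val_inj/(congr1 val)/= e; apply/eqP/val_inj.
Qed.
End Packing.
End Frames.

(** * Shortest walks avoiding a set *)

Lemma ex_shortest (T : finType) (P : pred (seq T)) : (exists l, P l) ->
  exists2 l, P l & forall l', P l' -> size l <= size l'.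
Proof.
case=> l0 P0.
have ex : exists n, [exists t : n.-tuple T, P t].
  by exists (size l0); apply/existsP; exists (in_tuple l0).
case: (ex_minnP ex) => n /existsP[t Pt] min_n; exists t => // l Pl.
by rewrite size_tuple; apply: min_n; apply/existsP; exists (in_tuple l).
Qed.

Section Walks.
Variables (G : sgraph) (X : {set G}) (x0 : G).
Implicit Types l m : seq G.

Definition walk l := sorted (@edge G) l && all (fun v => v \notin X) l.

Lemma walk_cat l m : walk l -> walk m ->
  (l != [::] -> m != [::] -> edge (last x0 l) (head x0 m)) -> walk (l ++ m).
Proof.
move=> /andP[lP lX] /andP[mP mX] lm; apply/andP; rewrite all_cat lX mX; split=> //.
case: l lP lm {lX} => //= x l lP; case: m mP {mX} => [|y m] /=; first by rewrite cats0.
by move=> mP /(_ isT isT) e; rewrite cat_path lP /= e.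
Qed.

Lemma walk_take l n : walk l -> walk (take n l).
Proof.
case/andP=> lP /allP lX; apply/andP; split; first exact: take_sorted.
by apply/allP => v /mem_take /lX.
Qed.

Lemma walk_drop l n : walk l -> walk (drop n l).
Proof.
case/andP=> lP /allP lX; apply/andP; split; first exact: drop_sorted.
by apply/allP => v /mem_drop /lX.
Qed.

Lemma walk1 v : v \notin X -> walk [:: v].
Proof. by rewrite /walk /= andbT. Qed.

Lemma last_take l i : i < size l -> last x0 (take i.+1 l) = nth x0 l i.
Proof. by move=> lt_i; rewrite (take_nth x0) // last_rcons. Qed.

Lemma head_take l i : head x0 (take i.+1 l) = head x0 l.
Proof. by case: l. Qed.

Lemma last_drop l i : i < size l -> last x0 (drop i l) = last x0 l.
Proof. by move=> lt_i; rewrite -{2}(cat_take_drop i l) last_cat (drop_nth x0). Qed.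

Lemma head_drop l i : head x0 (drop i l) = nth x0 l i.
Proof. by rewrite -nth0 nth_drop addn0. Qed.

Lemma nth_walk l i : walk l -> i.+1 < size l -> edge (nth x0 l i) (nth x0 l i.+1).
Proof.
case/andP=> + _; case: l => //= x l /pathP lP lt_i.
by have := lP x0 _ lt_i.
Qed.

(** Only walks with the same two ends compete, so walks that are shortest for
    different end conditions, such as legs and walks between vertices of [A],
    are all geodesic. *)
Definition geodesic l := walk l /\ forall l', walk l' -> l' != [::] ->
  head x0 l' = head x0 l -> last x0 l' = last x0 l -> size l <= size l'.

Section Geodesic.
Variable l : seq G.
Hypothesis gl : geodesic l.
Let wl : walk l := proj1 gl.

(** The way through [m] replaces [j - i - 1] inner vertices by [size m]. *)
Lemma geodesic_shortcut i j m : i < size l -> j < size l ->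
  walk (take i.+1 l ++ m ++ drop j l) -> j <= i.+1 + size m.
Proof.
move=> lt_i lt_j wm; have := proj2 gl _ wm.
rewrite !size_cat size_takel // size_drop => H.
suff : size l <= i.+1 + (size m + (size l - j)) by lia.
apply: H.
- by case: (l) lt_i.
- by case: (l) lt_i.
- by rewrite !last_cat (drop_nth x0 lt_j) -(last_drop lt_j) (drop_nth x0 lt_j).
Qed.

Lemma geodesic_induced i j : i < j < size l -> edge (nth x0 l i) (nth x0 l j) ->
  j = i.+1.
Proof.
move=> /andP[lt_ij lt_j] e; have lt_i := ltn_trans lt_ij lt_j.
have : j <= i.+1 + size (nil : seq G).
  apply: geodesic_shortcut => //; apply: walk_cat; [exact: walk_take|exact: walk_drop|].
  by move=> _ _; rewrite last_take // head_drop.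
by rewrite addn0; lia.
Qed.

Lemma geodesic_detour i j v : i < j < size l -> v \notin X ->
  edge v (nth x0 l i) -> edge v (nth x0 l j) -> j <= i.+2.
Proof.
move=> /andP[lt_ij lt_j] vX vi vj; have lt_i := ltn_trans lt_ij lt_j.
have : j <= i.+1 + size [:: v].
  apply: geodesic_shortcut => //; apply: walk_cat; first exact: walk_take.
    apply: walk_cat; [exact: walk1|exact: walk_drop|].
    by move=> _ _; rewrite head_drop.
  by move=> _ _; rewrite last_take // edge_sym.
by rewrite addn1.
Qed.

(** A repetition could be cut out; at the start of the walk by dropping a
    prefix, elsewhere because it gives an edge that skips vertices. *)
Lemma geodesic_uniq : uniq l.
Proof.
apply/(uniqP x0); suff H i j : i < j < size l -> nth x0 l i <> nth x0 l j.
  move=> i j; rewrite !inE => lt_i lt_j e.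
  case: (ltngtP i j) => // lt; [case: (H i j)|case: (H j i)] => //.
    by rewrite lt.
  by rewrite lt.
move=> /andP[lt_ij lt_j] e; case: i lt_ij e => [|i] lt_ij e.
  have := proj2 gl _ (walk_drop j wl); rewrite size_drop => H.
  suff : size l <= size l - j by lia.
  apply: H; last exact: last_drop.
    by rewrite -size_eq0 size_drop subn_eq0 -ltnNge.
  by rewrite head_drop -e nth0.
have := @geodesic_induced i j; rewrite -e => /(_ _ (nth_walk wl _)).
by lia.
Qed.
End Geodesic.
End Walks.

(** * Adding a walk to a frame *)

Section Extension.
Variables (G : sgraph) (A : {set G}) (s : seq G) (par : G -> G) (T Z : {set G}).
Hypothesis fr : frame A s par T Z.
Let X := ball Z 4.
(** The vertex [y] becomes the parent of the last vertex [b] of [l]: it is in the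
    forest when [l] is a leg, and is [b] itself, making [b] a root, when [l] is
    a new component.  This lets one argument serve both cases. *)
Variables (x0 y : G) (l : seq G).
Hypothesis gl : geodesic X x0 l.
Hypothesis l_gt0 : 0 < size l.
Let a := head x0 l.
Let b := last x0 l.
Hypothesis l_s : {in l, forall x, x \notin s}.
Hypothesis aA : a \in A.
Hypothesis lA : {in l, forall x, x \in A -> x = a \/ x = b}.
Hypothesis yP : (y \in s /\ edge b y) \/ [/\ y = b, b \in A & a <> b].
Hypothesis attach : forall x h, x \in l -> h \in s -> edge x h ->
  [/\ x = b, y \in s & h \in [:: y; par y; par (par y)]].
Let Z' := a |: (b |: Z).
Hypothesis mixed : forall v x h, v \notin ball Z' 4 ->
  x \in l -> h \in s -> edge v x -> edge v h -> False.

Definition ext_par v := if v \in l then nth y l (index v l).+1 else par v.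
Notation par' := ext_par.
Notation s' := (l ++ s).
Notation T' := (a |: T).

Let ul : uniq l := geodesic_uniq gl.
Let wl : walk X l := proj1 gl.

Let s_l v : v \in s -> v \notin l.
Proof. by move=> vs; apply/negP => /l_s; rewrite vs. Qed.

Let l_X v : v \in l -> v \notin X.
Proof. by case/andP: wl => _ /allP; apply. Qed.

Let lP v : v \in l -> exists2 i, i < size l & v = nth x0 l i.
Proof. by move=> vl; exists (index v l); rewrite ?index_mem ?nth_index. Qed.

Let par_s v : v \in s -> par' v = par v.
Proof. by move=> vs; rewrite /ext_par (negPf (s_l vs)). Qed.

Let par_l i : i.+1 < size l -> par' (nth x0 l i) = nth x0 l i.+1.
Proof.
move=> lt_i; have lt := ltnW lt_i.
by rewrite /ext_par mem_nth // index_uniq //; apply: set_nth_default.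
Qed.

Let bE : b = nth x0 l (size l).-1.
Proof. by rewrite nth_last. Qed.

Let aE : a = nth x0 l 0.
Proof. by rewrite nth0. Qed.

Let bl : b \in l.
Proof. by rewrite bE mem_nth // prednK. Qed.

Let al : a \in l.
Proof. by rewrite aE mem_nth. Qed.

Let par_b : par' b = y.
Proof. by rewrite /ext_par bl {1}bE index_uniq ?prednK // nth_default. Qed.

Let par_lP v : v \in l -> (exists i, [/\ i.+1 < size l, v = nth x0 l i & par' v = nth x0 l i.+1])
  \/ v = b /\ par' v = y.
Proof.
case/lP=> i lt_i ->; case: (ltnP i.+1 (size l)) => le_i; last first.
  by right; rewrite (_ : i = (size l).-1) -?bE //; lia.
by left; exists i; rewrite par_l.
Qed.

Let y_cases : (y \in s /\ edge b y) \/ (y \in l /\ y = b).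
Proof. by case: yP => [|[-> _ _]]; [left|right]. Qed.

Let kids_l i : i < size l -> kids s' par' (nth x0 l i) \subset
  (if i is j.+1 then [set nth x0 l j] else set0).
Proof.
move=> lt_i; apply/subsetP => c; rewrite inE mem_cat => /and3P[cs' /eqP pc cn].
have nl : nth x0 l i \in l by rewrite mem_nth.
case/orP: cs' => [cl|cs]; last first.
  rewrite par_s // in pc.
  have [|ps _ _] := frame_par fr cs; first by rewrite pc => /eqP; rewrite eq_sym (negPf cn).
  by move: (l_s nl); rewrite -pc ps.
case: (par_lP cl) => [[j [lt_j cE pcE]]|[cE pcE]].
  have /eqP : nth x0 l j.+1 = nth x0 l i by rewrite -pcE.
  by rewrite nth_uniq // => /eqP <-; rewrite inE cE.
move: pc; rewrite pcE => yE; case: y_cases => [[ys _]|[_ yb]].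
  by move: (l_s nl); rewrite -yE ys.
by move: cn; rewrite cE -yE yb eqxx.
Qed.

Let single_l v : v \in l -> single s' par' v.
Proof.
case/lP=> i lt_i ->; apply: leq_trans (subset_leq_card (kids_l lt_i)) _.
by case: i {lt_i} => [|i]; rewrite ?cards0 ?cards1.
Qed.

Let kids_old v : v \notin l -> kids s' par' v \subset
  (if v == y then b |: kids s par v else kids s par v).
Proof.
move=> vl; apply/subsetP => c; rewrite [in X in X -> _]inE mem_cat => /and3P[cs' /eqP pc cn].
case/orP: cs' => [cl|cs].
  case: (par_lP cl) => [[j [lt_j cE pcE]]|[cE pcE]].
    by move: vl; rewrite -pc pcE mem_nth.
  by rewrite -pc pcE eqxx !inE cE eqxx.
rewrite par_s // in pc.
have : c \in kids s par v by rewrite inE cs pc eqxx.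
by case: ifP => _ // ck; rewrite in_setU ck orbT.
Qed.

Let single_old v : v <> y -> single s par v -> single s' par' v.
Proof.
move=> /eqP/negPf vy sv; case vl: (v \in l); first exact: single_l.
apply: leq_trans sv; apply: subset_leq_card; have := kids_old (negbT vl).
by rewrite vy.
Qed.

Let Z_Z' : Z \subset Z'.
Proof. by rewrite /Z' setUA subsetUr. Qed.

Let far_ball v : v \notin ball Z' 4 -> v \notin ball Z 4.
Proof. by apply: contra; apply: (subsetP (ball_mono 4 Z_Z')). Qed.

(* Walks of [G - X] are far from the previous [Z], and so is [y]. *)
Let b_far : b \notin near Z 4.
Proof. exact: far_of_ball (l_X bl). Qed.

Let y_far : y \notin near Z 3.
Proof.
case: y_cases => [[_ by_]|[_ ->]]; first exact: far_step b_far by_.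
exact: far_le b_far.
Qed.

Let single_far v : v \notin near Z 1 -> single s par v.
Proof. by apply: contraR; apply: frame_branch fr v. Qed.

Let far_neq v r : r <= 3 -> v \in near Z r -> v <> y.
Proof. by move=> le_r vZ vy; move: (far_le le_r y_far); rewrite -vy vZ. Qed.

(** Only [y] gains a child, so only links at [y] could be spoilt.  But [y] is far
    from [Z]: chords, which leave vertices of [Z], do not come near it, and
    beside it are no branch vertices. *)
Let ext_link x z : x \in s -> edge x z -> link s par Z x z -> link s' par' Z' x z.
Proof.
move=> xs xz lk.
have inZ v : v \in Z -> v \in Z' by apply: (subsetP Z_Z').
have par_ss v : v \in s -> par v <> v -> par v \in s by move=> vs /(frame_par fr vs)[].
have zx : edge z x by rewrite edge_sym.
have old_far v : v \notin near Z 1 -> v <> y -> single s' par' v.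
  by move=> vZ vy; apply: single_old => //; apply: single_far.
case: lk.
- case=> nr zE sxz; apply: Or31; split; rewrite ?par_s //.
  case: (eqVneq x y) => [xy|/eqP xy].
    apply/orP; right; apply: old_far; last by rewrite -xy zE.
    by apply: (@far_le _ _ 2) => //; apply: far_step y_far _; rewrite -xy.
  case: (eqVneq z y) => [zy|/eqP zy].
    apply/orP; left; apply: old_far => //.
    by apply: (@far_le _ _ 2) => //; apply: far_step y_far _; rewrite -zy.
  by case/orP: sxz => sv; apply/orP; [left|right]; apply: single_old.
- case=> xZ sx nr1 nr2 [zE sz]; apply: Or32.
  have p1s := par_ss _ xs nr1.
  have xy : x <> y by apply: (@far_neq x 0).
  have zy : z <> y by apply: (@far_neq z 1) => //; apply: near_step (xZ : x \in near Z 0) xz.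
  by split; rewrite ?par_s //; auto.
- case=> xZ sx nr1 nr2 [nr3 zE s2 sz]; apply: Or33.
  have p1s := par_ss _ xs nr1.
  have p2s := par_ss _ p1s nr2.
  have xy : x <> y by apply: (@far_neq x 0).
  have z1 : z \in near Z 1 by apply: near_step (xZ : x \in near Z 0) xz.
  have zy : z <> y by apply: (@far_neq z 1).
  have p2y : par (par x) <> y.
    apply: (@far_neq _ 2) => //; apply: near_step z1 _.
    by rewrite edge_sym zE; have [] := frame_par fr p2s nr3.
  by split; rewrite ?(par_s xs) ?(par_s p1s) ?(par_s p2s); auto; split; auto.
Qed.

(** The invariants near [l] come from [l] being geodesic, those at the attachment
    from the window of [b] and its distance from the previous [Z]. *)
Lemma frame_extend : frame A s' par' T' Z'.
Proof.
have ls i : i < size l -> nth x0 l i \in l by move=> ?; rewrite mem_nth.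
have y_new v : v \in near Z 3 -> v <> y by apply: far_neq.
have Zn r v : v \in Z -> v \in near Z r by apply: (subsetP (near_sub Z (leq0n r))).
have kids_ss v : v \in s -> v <> y -> kids s' par' v \subset kids s par v.
  by move=> vs /eqP/negPf vy; have := kids_old (s_l vs); rewrite vy.
split.
- rewrite cat_uniq ul (frame_uniq fr) andbT /=; apply/hasPn => v vs; exact: s_l.
- move=> v; rewrite mem_cat => /orP[vl|vs] nr.
    case: (par_lP vl) => [[i [lt_i vE pE]]|[vE pE]].
      rewrite pE mem_cat ls // vE; split=> //; first exact: nth_walk wl lt_i.
      by rewrite !index_cat !ls ?index_uniq ?(ltnW lt_i).
    case: y_cases => [[ys e]|[_ yb]]; last by case: nr; rewrite pE yb.
    rewrite pE mem_cat ys orbT vE; split=> //.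
    rewrite !index_cat bl (negPf (s_l ys)); apply: leq_trans (leq_addr _ _).
    by rewrite index_mem.
  rewrite par_s // in nr *; have [ps e lt] := frame_par fr vs nr.
  by rewrite mem_cat ps orbT !index_cat !(negPf (s_l _)) // ltn_add2l.
- move=> v; rewrite mem_cat => /orP[vl|vs] rv.
    case: (par_lP vl) => [[i [lt_i vE pE]]|[vE pE]].
      by move/eqP: rv; rewrite pE vE nth_uniq ?(ltnW lt_i) // eqn_leq ltnn.
    case: yP => [[ys _]|[yb bA _]]; first by move: (l_s vl); rewrite -rv pE ys.
    by rewrite vE bA !inE eqxx orbT single_l.
  rewrite par_s // in rv; have [vZ vA sv] := frame_root fr vs rv.
  rewrite vA (subsetP Z_Z' _ vZ); split=> //.
  by apply: single_old sv; apply/y_new/Zn.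
- move=> v; case/setU1P => [->|vT].
    rewrite mem_cat al aA !inE eqxx; split=> //.
      case: (par_lP al) => [[i [lt_i ai ->]]|[ab ->]].
        by rewrite ai => /eqP; rewrite nth_uniq ?(ltnW lt_i) // eqn_leq ltnn.
      case: yP => [[ys _] ya|[yb _ nab]].
        by move: (l_s al); rewrite -ya ys.
      by move=> ya; apply: nab; rewrite -ya yb.
    by apply/eqP; rewrite -subset0 aE; apply: (kids_l l_gt0).
  have [vs vA vZ nr k0] := frame_tip fr vT.
  rewrite mem_cat vs orbT vA (subsetP Z_Z' _ vZ) par_s //; split=> //.
  by apply/eqP; rewrite -subset0 -k0; apply: kids_ss => //; apply/y_new/Zn.
- move=> v; case vl: (v \in l); first by apply: leq_trans (single_l vl) _.
  apply: leq_trans (subset_leq_card (kids_old (negbT vl))) _.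
  case: eqP => [->|_]; last exact: frame_kids fr v.
  rewrite cardsU1; apply: (@leq_add _ _ 1 1); first by case: (_ \in _).
  by apply: single_far; apply: far_le y_far.
- move=> v; case vl: (v \in l); first by rewrite single_l.
  case: (eqVneq v y) => [vy|/eqP vy] nsv.
    case: y_cases => [[ys e]|[yl _]]; last by rewrite vy yl in vl.
    rewrite vy; apply: near_step (e); rewrite /= !inE eqxx orbT //.
  apply: (subsetP (near_mono 1 Z_Z')); apply: (frame_branch fr).
  by apply: contra nsv; apply: single_old.
- move=> v; rewrite mem_cat => /orP[vl|vs] vA.
    by case: (lA vl vA) => ->; rewrite !inE eqxx ?orbT.
  by apply: (subsetP Z_Z'); apply: (frame_A fr) vs vA.
- have consecutive i j : i < j < size l -> edge (nth x0 l i) (nth x0 l j) ->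
      link s' par' Z' (nth x0 l i) (nth x0 l j).
    move=> ij e; have ji := geodesic_induced gl ij e; case/andP: ij => lt_ij lt_j.
    rewrite ji in lt_j *; have lt_i := ltnW lt_j; apply: Or31; rewrite par_l //; split=> //.
      by move/eqP; rewrite nth_uniq // eqn_leq ltnn.
    by rewrite single_l ?ls.
  have cross x h : x \in l -> h \in s -> edge x h -> link s' par' Z' x h.
    move=> xl hs xh; have [xb ys hy] := attach xl hs xh.
    rewrite xb in xh *.
    have by_ : b <> y by move=> e; move: (s_l ys); rewrite -e bl.
    have bZ : b \in Z' by rewrite !inE eqxx orbT.
    have sb := single_l bl.
    have old_far v : v \notin near Z 1 -> v <> y -> single s' par' v.
      by move=> vZ vy; apply: single_old => //; apply: single_far.
    (* The neighbour [h] of [b] is [y] or one of the two vertices above it. *)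
    case: (eqVneq h y) => [->|/eqP hy1].
      by apply: Or31; rewrite par_b sb; split=> //; apply/nesym.
    have h_far : h \notin near Z 3 by apply: far_step b_far xh.
    have sh : single s' par' h by apply: old_far => //; apply: far_le h_far.
    have nry : par y <> y.
      by move=> e; move: hy; rewrite !inE !e; move/eqP/negPf: hy1 => ->.
    have [p1s e1 lt1] := frame_par fr ys nry.
    case: (eqVneq h (par y)) => [hE|/eqP hy2].
      apply: Or32; rewrite par_b par_s //; split=> //; exact/nesym.
    have hE : h = par (par y).
      by move: hy; rewrite !inE; move/eqP/negPf: hy1 => ->; move/eqP/negPf: hy2 => -> /eqP.
    have nr2 : par (par y) <> par y by move=> e; rewrite e in hE.
    apply: Or33; rewrite par_b !par_s //; split=> //; first exact/nesym.
    split=> //; apply: old_far => //; apply: (@far_le _ _ 2) => //; exact: far_step y_far e1.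
  move=> x z; rewrite !mem_cat => /orP[xl|xs] /orP[zl|zs] e.
  - have [i lt_i xE] := lP xl; have [j lt_j zE] := lP zl; rewrite xE zE in e *.
    case: (ltngtP i j) => ij; last by rewrite ij edge_irr in e.
      by left; apply: consecutive; rewrite ?ij.
    by right; apply: consecutive; rewrite ?ij // edge_sym.
  - by left; apply: cross.
  - by right; apply: cross; rewrite // edge_sym.
  - case: (frame_link fr xs zs e) => lk; [left|right]; apply: ext_link lk => //.
    by rewrite edge_sym.
- move=> v vX vs' [h]; rewrite mem_cat in vs'; case/norP: vs' => vl vs.
  have far_v := far_ball vX.
  case: (boolP (has (edge v) l)) => [/hasP[x xl vx] _ _|/hasPn nl].
    have no_s h' : h' \in s -> edge v h' -> False by move=> h's; apply: mixed vX xl h's vx.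
    have ex : exists i, (i < size l) && edge v (nth x0 l i).
      by have [i lt_i xE] := lP xl; exists i; rewrite lt_i -xE.
    case: (ex_minnP ex) => i /andP[lt_i vi] min_i.
    exists (nth x0 l i); split=> //; first by rewrite mem_cat ls.
    move=> z; rewrite mem_cat => /orP[zl|zs] vz; last by case: (no_s _ zs vz).
    have [j lt_j zE] := lP zl; rewrite zE in vz *.
    have le_ij : i <= j by apply: min_i; rewrite lt_j.
    case: (ltngtP i j) le_ij => // [lt_ij _|-> _]; last by rewrite inE eqxx.
    have le_j : j <= i.+2 by apply: (geodesic_detour gl) vi vz => //; rewrite lt_ij.
    have [jE|jE] : j = i.+1 \/ j = i.+2.
      by move: lt_ij le_j; clear; lia.
      by rewrite jE par_l -?jE // !inE eqxx orbT.
    have lt_j1 : i.+1 < size l by apply: ltnW; rewrite -jE.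
    by rewrite par_l // par_l -?jE // !inE eqxx !orbT.
  rewrite mem_cat => /orP[/nl/negP//|hs] vh.
  have [|w [ws vw wP]] := frame_window fr far_v vs; first by exists h.
  exists w; split=> //; first by rewrite mem_cat ws orbT.
  move=> z; rewrite mem_cat => /orP[/nl/negP//|zs] vz.
  rewrite par_s //; case: (eqVneq (par w) w) => [e|/eqP nr].
    by move: (wP z zs vz); rewrite e !par_s // e.
  have [ps _ _] := frame_par fr ws nr.
  by rewrite par_s //; apply: wP.
- rewrite (cardsU1 a T) (_ : a \notin T); last first.
    by apply/negP => /(frame_tip fr)[as_]; move: (l_s al); rewrite as_.
  rewrite mulnDr; apply: (@leq_trans (1 + (1 + #|Z|))).
    rewrite !cardsU1; apply: (@leq_add _ _ 1); first by case: (_ \notin _).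
    by apply: (@leq_add _ _ 1) => //; case: (_ \notin _).
  by rewrite addnA muln1 leq_add2l (frame_card fr).
Qed.
End Extension.

(** * The greedy process *)

Section Growth.
Variables (G : sgraph) (A : {set G}).

Section Step.
Variables (s : seq G) (par : G -> G) (T Z : {set G}) (x0 : G).
Hypothesis fr : frame A s par T Z.
Notation X := (ball Z 4).

Definition touches v := (v \in s) || has (edge v) s.

(** Legs and [Awalk]s may repeat vertices: only shortest ones are used, and these
    are geodesic. *)
Definition leg l :=
  [&& l != [::], walk X l, head x0 l \in A & touches (last x0 l)].

Definition Awalk l :=
  [&& walk X l, head x0 l \in A, last x0 l \in A & head x0 l != last x0 l].

(** This and the next lemma produce the competitors of a shortest leg. *)
Lemma leg_take l i : walk X l -> head x0 l \in A -> i < size l ->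
  touches (nth x0 l i) -> leg (take i.+1 l).
Proof.
move=> wl hA lt_i ti; rewrite /leg walk_take // head_take hA last_take // ti.
by case: l lt_i {wl hA ti}.
Qed.

Lemma leg_detour l i v : walk X l -> head x0 l \in A -> i < size l ->
  v \notin X -> edge v (nth x0 l i) -> touches v -> leg (take i.+1 l ++ [:: v]).
Proof.
move=> wl hA lt_i vX vi tv; rewrite /leg last_cat tv andbT.
rewrite (walk_cat (x0 := x0)) ?walk_take ?walk1 //.
  by case: l lt_i hA {wl vi} => //= x l _ ->.
by move=> _ _; rewrite last_take // edge_sym.
Qed.

Lemma touches_edge v h : h \in s -> edge v h -> touches v.
Proof. by move=> hs vh; apply/orP; right; apply/hasP; exists h. Qed.

(** A prefix of the shortest leg that touches the forest is the whole leg, so only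
    its last vertex touches the forest; a suffix that starts in [A] is the whole
    leg, so only its first vertex is in [A]. *)
Lemma grow_leg : (exists l, leg l) -> exists s' par' T' Z',
  frame A s' par' T' Z' /\ size s < size s'.
Proof.
case/ex_shortest => l /and4P[l_nil wl aA tb] min_l.
have l_gt0 : 0 < size l by rewrite lt0n size_eq0.
have lX v : v \in l -> v \notin X by case/andP: wl => _ /allP; apply.
have gl : geodesic X x0 l.
  split=> // l' wl' nl' he la; apply: min_l; rewrite /leg nl' wl' he la aA; exact: tb.
have touch_last i : i < size l -> touches (nth x0 l i) -> i = (size l).-1.
  move=> lt_i ti; have := min_l _ (leg_take wl aA lt_i ti).
  by rewrite size_takel //; lia.
have l_s : {in l, forall x, x \notin s}.
  move=> x /[dup] /(nthP x0)[i lt_i <-] xl; apply/negP => xs.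
  have iE : i = (size l).-1 by apply: touch_last => //; rewrite /touches xs.
  case: i iE lt_i xs xl => [|i] iE lt_i xs xl.
    have := lX _ xl; rewrite nth0 in xs *.
    have aZ := frame_A fr xs aA.
    by move/far_of_ball/(far_le (leq0n 4)); rewrite /= aZ.
  have e := nth_walk x0 wl lt_i.
  have := touch_last i (ltnW lt_i) (touches_edge xs e); rewrite -iE; lia.
have lA : {in l, forall x, x \in A -> x = head x0 l \/ x = last x0 l}.
  move=> x /(nthP x0)[i lt_i <-] xA; left.
  suff -> : i = 0 by rewrite nth0.
  have := min_l (drop i l); rewrite size_drop => H.
  suff : size l <= size l - i by lia.
  apply: H; rewrite /leg walk_drop // head_drop xA last_drop // tb andbT.
  by rewrite !andbT -size_eq0 size_drop subn_eq0 -ltnNge.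
have bl : last x0 l \in l by rewrite -nth_last mem_nth // prednK.
have bs := l_s _ bl.
have [|y [ys yb yP]] := frame_window fr (lX _ bl) bs.
  by move: tb; rewrite /touches (negPf bs) => /hasP.
exists (l ++ s), (ext_par par y l), (head x0 l |: T),
  (head x0 l |: (last x0 l |: Z)); split; last by rewrite size_cat; lia.
apply: (frame_extend fr gl) => //; first by left.
- move=> x h /(nthP x0)[i lt_i <-] hs e.
  have iE := touch_last i lt_i (touches_edge hs e).
  by rewrite iE nth_last in e *; split=> //; apply: yP.
- move=> v x h vZ /(nthP x0)[i lt_i <-] hs vx vh.
  have vX : v \notin X.
    by apply: contra vZ; apply/subsetP/ball_mono; rewrite setUA subsetUr.
  have := min_l _ (leg_detour wl aA lt_i vX vx (touches_edge hs vh)).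
  rewrite size_cat size_takel //= => le_l.
  (* The detour leg has [i + 2] vertices, so [x] is the last vertex of [l] or the
     one before it, and [v] is within distance 2 of the last one. *)
  have x_far := far_step (far_of_ball vZ) vx.
  have b_near r : last x0 l \in near (head x0 l |: (last x0 l |: Z)) r.
    apply: (subsetP (near_sub _ (leq0n r))); by rewrite /= !inE eqxx orbT.
  case: (ltnP i.+1 (size l)) => [lt_i1|ge_i1]; last first.
    have iE : i = (size l).-1.
      by apply/eqP; rewrite -eqSS prednK // eqn_leq lt_i.
    by move: x_far; rewrite iE nth_last b_near.
  have iE : i.+1 = (size l).-1.
    by apply/eqP; rewrite -eqSS prednK // eqn_leq lt_i1; move: le_l; rewrite addn1.
  have e := nth_walk x0 wl lt_i1.
  by have := far_step x_far e; rewrite iE nth_last b_near.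
Qed.

(** A vertex of the new walk that touches the forest would complete a leg, and so
    would a vertex outside the ball that is adjacent to both. *)
Lemma grow_component : ~ (exists l, leg l) -> (exists l, Awalk l) ->
  exists s' par' T' Z', frame A s' par' T' Z' /\ size s < size s'.
Proof.
move=> no_leg /ex_shortest[l /and4P[wl aA bA ab] min_l].
have l_gt0 : 0 < size l by case: (l) ab; rewrite ?eqxx.
have gl : geodesic X x0 l.
  by split=> // l' wl' nl' he la; apply: min_l; rewrite /Awalk wl' he la aA bA.
have no_touch x h : x \in l -> h \in s -> edge x h -> False.
  move=> /(nthP x0)[i lt_i <-] hs e; apply: no_leg.
  by exists (take i.+1 l); apply: leg_take (touches_edge hs e).
exists (l ++ s), (ext_par par (last x0 l) l), (head x0 l |: T),
  (head x0 l |: (last x0 l |: Z)); split; last by rewrite size_cat; lia.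
apply: (frame_extend fr gl) => //.
- move=> x /(nthP x0)[i lt_i <-]; apply/negP => xs; apply: no_leg.
  by exists (take i.+1 l); apply: leg_take => //; rewrite /touches xs.
- move=> x /(nthP x0)[i lt_i <-] xA.
  case: (eqVneq (nth x0 l i) (last x0 l)) => [|nb]; [by right|left].
  suff -> : i = 0 by rewrite nth0.
  have := min_l (drop i l); rewrite size_drop => H.
  suff : size l <= size l - i by lia.
  by apply: H; rewrite /Awalk walk_drop // head_drop xA last_drop // bA.
- by right; split=> //; apply/eqP.
- by move=> x h xl hs e; case: (no_touch x h).
- move=> v x h vZ /(nthP x0)[i lt_i <-] hs vx vh; apply: no_leg.
  have vX : v \notin X.
    by apply: contra vZ; apply/subsetP/ball_mono; rewrite setUA subsetUr.
  by exists (take i.+1 l ++ [:: v]); apply: leg_detour (touches_edge hs vh).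
Qed.
End Step.

Lemma frame_grow s par T Z : frame A s par T Z ->
  (exists p, Apath_avoiding (ball Z 4) A p) ->
  exists s' par' T' Z', frame A s' par' T' Z' /\ size s < size s'.
Proof.
move=> fr [[|x0 q] /andP[] //= /and4P[/andP[pP pU] q_gt0 x0A lA] pX].
case: (classic (exists l, leg s Z x0 l)) => [/(grow_leg fr)//|no_leg].
apply: (grow_component fr no_leg); exists (x0 :: q).
rewrite /Awalk /walk /= pP x0A lA pX /=.
case: q q_gt0 pU {pP lA pX} => //= x q _ /andP[+ _].
by apply: contraNneq => ->; apply: mem_last.
Qed.

(** Frames grow strictly inside [G], so the process stops. *)
Lemma hitting_frame : exists s par T Z, frame A s par T Z /\
  ~ (exists p, Apath_avoiding (ball Z 4) A p).
Proof.
suff H n s par T Z : #|G| - size s < n -> frame A s par T Z ->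
    exists s par T Z, frame A s par T Z /\
      ~ (exists p, Apath_avoiding (ball Z 4) A p).
  exact: H (ltnSn _) (frame0 A).
elim: n s par T Z => // n IHn s par T Z lt_n fr.
case: (classic (exists p, Apath_avoiding (ball Z 4) A p)) => [ex|no]; last first.
  by exists s, par, T, Z.
have [s' [par' [T' [Z' [fr' lt]]]]] := frame_grow fr ex.
have le_s' : size s' <= #|G|.
  by rewrite cardE; apply: uniq_leq_size (frame_uniq fr') _ => x _; rewrite mem_enum.
by apply: IHn (fr'); move: lt_n lt le_s'; clear; lia.
Qed.
End Growth.

Theorem theorem4 (k : nat) (hk : 0 < k) (G : sgraph) (A : {set G}) :
  (exists P : 'I_k -> seq G,
      (forall i, Apath A (P i)) /\
      (forall i j, i != j ->
         anticomplete [set x in P i] [set x in P j]))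
  \/
  (exists Z : {set G},
      #|Z| <= 4 * (k - 1) /\
      ~ (exists s : seq G, Apath_avoiding (ball Z 4) A s)).
Proof.
have [s [par [T [Z [fr no_path]]]]] := hitting_frame A.
case: (ltnP (2 * k.-1) #|T|) => [lt_T|le_T]; [left|right].
  by have := frame_packing fr lt_T; exact.
exists Z; split=> //; apply: leq_trans (frame_card fr) _; lia.
Qed.
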